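(* Let $G$ be a connected $\{K_{1,3},B_{1,2}\}$-free graph. Then $G$ is not $P_{6}$-free if and only if $G\in\mathcal{P}(6)$.
   Context: All graphs are finite and simple. A graph is $\mathcal{F}$-free if it contains no member of $\mathcal{F}$ as an induced subgraph. $K_{1,3}$ is the star with three leaves, $P_n$ is the path on $n$ vertices. $B_{1,2}$ is obtained from a triangle $abc$ by adding a vertex $p$ adjacent only to $a$ and a path $b q r$ with new vertices $q,r$ (edges $bq,qr$). For an integer $l\geq 5$ and pairwise vertex-disjoint nonempty cliques $L_1,\dots,L_l$, the fat $l$-path $F_p(L_1,\dots,L_l)$ is the graph on $L_1\cup\dots\cup L_l$ in which each $L_i$ is a clique, every vertex of $L_i$ is adjacent to every vertex of $L_{i+1}$ for $1\leq i\leq l-1$, and there are no other edges. For pairwise vertex-disjoint nonempty cliques $L_0,\dots,L_l$, the fat $l$-cycle $F_c(L_0,\dots,L_l)$ is the graph on $L_0\cup\dots\cup L_l$ in which each $L_i$ is a clique, every vertex of $L_i$ is adjacent to every vertex of $L_{i+1}$ for $0\leq i\leq l$ (indices modulo $l+1$), and there are no other edges. For $l\geq 5$, $\mathcal{P}(l)$ denotes the family of all fat $i$-paths and fat $i$-cycles for all $i\geq l$ (membership up to isomorphism). *)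

(* Defs.v *)
From mathcomp Require Import all_boot.

Set Implicit Arguments.
Unset Strict Implicit.
Unset Printing Implicit Defensive.

Record sgraph := SGraph {
  vertex :> finType;
  adj : rel vertex;
  adj_sym : symmetric adj;
  adj_irrefl : irreflexive adj
}.

Definition gfamily := sgraph -> Prop.

Definition induced_subgraph (H G : sgraph) : Prop :=
  exists2 f : H -> G, injective f & forall x y, adj (f x) (f y) = adj x y.

Definition isomorphic (G H : sgraph) : Prop :=
  exists2 f : G -> H, bijective f & forall x y, adj (f x) (f y) = adj x y.

Definition free (F : gfamily) (G : sgraph) : Prop :=
  forall H, F H -> ~ induced_subgraph H G.

Definition family1 (H : sgraph) : gfamily := fun K => K = H.
Definition family2 (H1 H2 : sgraph) : gfamily := fun K => K = H1 \/ K = H2.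

Definition connected (G : sgraph) : Prop := forall x y : G, connect (@adj G) x y.

Section SymmetricClosure.
Variables (T : finType) (r : rel T).

Definition sym_adj : rel T := fun x y => (x != y) && (r x y || r y x).

Lemma sym_adj_sym : symmetric sym_adj.
Proof. by move=> x y; rewrite /sym_adj eq_sym orbC. Qed.

Lemma sym_adj_irrefl : irreflexive sym_adj.
Proof. by move=> x; rewrite /sym_adj eqxx. Qed.

(* The simple graph whose edges are the pairs {x, y}, x != y, related by r in
   at least one direction. *)
Definition graph_of : sgraph := SGraph sym_adj_sym sym_adj_irrefl.
End SymmetricClosure.

Definition path_graph (n : nat) : sgraph :=
  graph_of (fun i j : 'I_n => i.+1 == j :> nat).

Definition claw : sgraph :=
  graph_of (fun i j : 'I_4 => (i == 0 :> nat) && (j != 0 :> nat)).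

(* a, b, c, p, q, r are encoded as 0, 1, 2, 3, 4, 5. *)
Definition B12 : sgraph :=
  graph_of (fun i j : 'I_6 => ((i : nat), (j : nat)) \in
    [:: (0, 1); (0, 2); (1, 2); (0, 3); (1, 4); (4, 5)]).

(* L_1, ..., L_l are indexed from 0 to l - 1; disjointness comes from taking
   their tagged union as vertex set. *)
Definition fat_path (l : nat) (L : 'I_l -> finType) : sgraph :=
  graph_of (fun u v : {i : 'I_l & L i} =>
    (tag u == tag v) || ((tag u).+1 == tag v :> nat)).

(* A fat l-cycle has l + 1 cliques; ordS is the successor modulo l + 1. *)
Definition fat_cycle (l : nat) (L : 'I_l.+1 -> finType) : sgraph :=
  graph_of (fun u v : {i : 'I_l.+1 & L i} =>
    (tag u == tag v) || (ordS (tag u) == tag v)).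

Definition is_fat_path (l : nat) : gfamily := fun G =>
  5 <= l /\ exists L : 'I_l -> finType,
    (forall i, 0 < #|L i|) /\ isomorphic G (fat_path L).

Definition is_fat_cycle (l : nat) : gfamily := fun G =>
  5 <= l /\ exists L : 'I_l.+1 -> finType,
    (forall i, 0 < #|L i|) /\ isomorphic G (fat_cycle L).

Definition fat_family (l : nat) : gfamily := fun G =>
  exists2 i, l <= i & is_fat_path i G \/ is_fat_cycle i G.

(* Main.v *)
Require Import Defs.
From mathcomp Require Import all_boot.
From mathcomp Require Import zify.

(** Take a longest induced path P in G, of order k >= 6. Testing the claw and
    B_{1,2} on six consecutive vertices of P shows that a vertex v meets P in
    the empty set, in the closed neighbourhood of a vertex of P, or in one or
    both ends of P only. A single end contradicts the choice of P, and both ends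
    give an induced cycle of length k + 1 >= 7. So G contains an induced path or
    cycle H all of whose copies in G are met by every vertex of G in the empty
    set or in the closed neighbourhood of a vertex of H. Label v by that vertex
    of H: substituting v for its label in the copy gives another copy, and the
    traces on the new copy show, by connectedness, that every vertex is labelled
    and that the adjacency of two vertices is that of their labels. *)

Set Implicit Arguments.
Unset Strict Implicit.
Unset Printing Implicit Defensive.

(** * Closed adjacency, embeddings and twins *)

(* With closed adjacency, maps out of a graph without twins that preserve it are
   automatically injective, so no distinctness conditions are needed. *)
Definition cadj (G : sgraph) : rel G := fun x y => (x == y) || adj x y.

Definition cadj_embedding (H G : sgraph) (f : H -> G) : Prop :=
  forall x y, cadj (f x) (f y) = cadj x y.

Definition twin_free (H : sgraph) : Prop :=
  forall x y : H, cadj x =1 cadj y -> x = y.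

Lemma cadj_refl (G : sgraph) (x : G) : cadj x x.
Proof. by rewrite /cadj eqxx. Qed.

Lemma cadj_sym (G : sgraph) (x y : G) : cadj x y = cadj y x.
Proof. by rewrite /cadj eq_sym adj_sym. Qed.

Lemma adjE (G : sgraph) (x y : G) : adj x y = (x != y) && cadj x y.
Proof. by rewrite /cadj; case: eqP => [->|//]; rewrite adj_irrefl. Qed.

Lemma cadj_embedding_inj (H G : sgraph) (f : H -> G) :
  twin_free H -> cadj_embedding f -> injective f.
Proof. by move=> tw fE x y fxy; apply: tw => z; rewrite -!fE fxy. Qed.

Lemma induced_subgraphP (H G : sgraph) : twin_free H ->
  induced_subgraph H G <-> exists f : H -> G, cadj_embedding f.
Proof.
move=> tw; split=> [[f fI fE]|[f fE]]; exists f.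
- by move=> x y; rewrite /cadj fE (inj_eq fI).
- exact: cadj_embedding_inj.
- by move=> x y; rewrite !adjE fE (inj_eq (cadj_embedding_inj tw fE)).
Qed.

(** Boolean, so that [ex_maxnP] and [boolP] apply to it. *)
Definition cadj_embeddable (H G : sgraph) : bool :=
  [exists f : {ffun H -> G}, forall x, forall y, cadj (f x) (f y) == cadj x y].

Lemma cadj_embeddableP (H G : sgraph) :
  reflect (exists f : H -> G, cadj_embedding f) (cadj_embeddable H G).
Proof.
apply: (iffP existsP) => [[f fE]|[f fE]].
  by exists f => x y; apply/eqP/(forallP (forallP fE x)).
by exists (finfun f); apply/forallP => x; apply/forallP => y; rewrite !ffunE fE.
Qed.

Lemma twin_free_claw : twin_free claw.
Proof.
move=> [i Hi] [j Hj] H; apply/val_inj => /=.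
move: (H (inord 1)) (H (inord 2)) (H (inord 3)).
rewrite /cadj /= /sym_adj -!val_eqE /= !inordK //.
by case: i Hi {H} => [|[|[|[|]]]] //= _; case: j Hj => [|[|[|[|]]]].
Qed.

Lemma twin_free_B12 : twin_free B12.
Proof.
move=> [i Hi] [j Hj] H; apply/val_inj => /=.
move: (H (inord 0)) (H (inord 1)) (H (inord 2)).
move: (H (inord 3)) (H (inord 4)) (H (inord 5)).
rewrite /cadj /= /sym_adj -!val_eqE /= !inordK //.
by case: i Hi {H} => [|[|[|[|[|[|]]]]]] //= _;
   case: j Hj => [|[|[|[|[|[|]]]]]].
Qed.

(** * Traces of a vertex on an induced path *)

Section Windows.
Variable G : sgraph.
Hypothesis Gfree : free (family2 claw B12) G.

Lemma no_claw (x a b c : G) :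
  ~~ [&& cadj x a, cadj x b, cadj x c, ~~ cadj a b, ~~ cadj a c & ~~ cadj b c].
Proof.
apply/negP => /and5P[xa xb xc /negbTE ab /andP[/negbTE ac /negbTE bc]].
apply: (Gfree (or_introl (erefl claw))).
apply/(induced_subgraphP G twin_free_claw).
exists (fun i : 'I_4 => nth x [:: x; a; b; c] i) => -[i Hi] [j Hj].
rewrite [RHS]/cadj /= /sym_adj -!val_eqE /=.
by case: i Hi => [|[|[|[|]]]] //= _; case: j Hj => [|[|[|[|]]]] //= _;
  rewrite ?cadj_refl // cadj_sym.
Qed.

Lemma no_B12 (a b c p q r : G) :
  ~~ [&& [&& cadj a b, cadj a c, cadj b c, cadj a p, cadj b q & cadj q r],
      ~~ cadj a q, ~~ cadj a r, ~~ cadj b p, ~~ cadj b r &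
      [&& ~~ cadj c p, ~~ cadj c q, ~~ cadj c r, ~~ cadj p q & ~~ cadj p r]].
Proof.
apply/negP => /and5P[/and5P[ab ac bc ap /andP[bq qr]]].
move=> /negbTE aq /negbTE ar /negbTE bp /andP[/negbTE br].
case/and5P=> /negbTE cp /negbTE cq /negbTE cr /negbTE pq /negbTE pr.
apply: (Gfree (or_intror (erefl B12))).
apply/(induced_subgraphP G twin_free_B12).
exists (fun i : 'I_6 => nth a [:: a; b; c; p; q; r] i) => -[i Hi] [j Hj].
rewrite [RHS]/cadj /= /sym_adj -!val_eqE /=.
by case: i Hi => [|[|[|[|[|[|]]]]]] //= _;
   case: j Hj => [|[|[|[|[|[|]]]]]] //= _; rewrite ?cadj_refl // cadj_sym.
Qed.

(** The condition on the right is |i - j| <= 1. As [p] is total on [nat], a window of the path is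
    just a shift of [p]. *)
Definition induced_path (k : nat) (p : nat -> G) : Prop :=
  forall i j, i < k -> j < k ->
  cadj (p i) (p j) = (i <= j.+1) && (j <= i.+1).

(** The empty set, one end, both ends, and the closed neighbourhoods of the six vertices of P_6. *)
Definition window_traces : seq bitseq := Eval compute in
  let bits A := [seq i \in A | i <- iota 0 6] in
  [seq bits A | A : seq nat <-
    [:: [::]; [:: 0]; [:: 5]; [:: 0; 5]; [:: 0; 1]; [:: 4; 5];
        [:: 0; 1; 2]; [:: 1; 2; 3]; [:: 2; 3; 4]; [:: 3; 4; 5]]].

(** Eighteen instances exclude the other 54 of the 64 traces: [C] and [D] are claws centred on the
    path and at [v]; [A], [B] and [E] are copies of B_{1,2} with [v] as [c], [a] and [b]. *)
Lemma window_trace (p : nat -> G) (v : G) : induced_path 6 p ->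
  [seq cadj v (p i) | i <- iota 0 6] \in window_traces.
Proof.
move=> pP.
have [C1 C2 C3 C4] :=
  And4 (no_claw (p 1) (p 0) (p 2) v) (no_claw (p 2) (p 1) (p 3) v)
       (no_claw (p 3) (p 2) (p 4) v) (no_claw (p 4) (p 3) (p 5) v).
have [D1 D2 D3 D4] :=
  And4 (no_claw v (p 0) (p 2) (p 4)) (no_claw v (p 0) (p 2) (p 5))
       (no_claw v (p 0) (p 3) (p 5)) (no_claw v (p 1) (p 3) (p 5)).
have [A1 A2 A3] :=
  And3 (no_B12 (p 1) (p 2) v (p 0) (p 3) (p 4))
       (no_B12 (p 2) (p 3) v (p 1) (p 4) (p 5))
       (no_B12 (p 4) (p 3) v (p 5) (p 2) (p 1)).
have [B1 B2 B3] :=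
  And3 (no_B12 v (p 1) (p 0) (p 5) (p 2) (p 3))
       (no_B12 v (p 2) (p 3) (p 5) (p 1) (p 0))
       (no_B12 v (p 3) (p 2) (p 0) (p 4) (p 5)).
have [E1 E2 E3 E4] :=
  And4 (no_B12 (p 1) v (p 0) (p 2) (p 4) (p 5))
       (no_B12 (p 1) v (p 2) (p 0) (p 4) (p 5))
       (no_B12 (p 4) v (p 5) (p 3) (p 0) (p 1))
       (no_B12 (p 4) v (p 5) (p 3) (p 1) (p 0)).
move: C1 C2 C3 C4 D1 D2 D3 D4 A1 A2 A3 B1 B2 B3 E1 E2 E3 E4.
rewrite !pP //= !(cadj_sym _ v).
by do 6! case: (cadj v _).
Qed.

(** The list of traces turned into local implications, to be applied to windows of longer paths and
    cycles. *)
Lemma windowP (p : nat -> G) (v : G) (T := fun n => cadj v (p n)) :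
  induced_path 6 p ->
  [/\ T 1 -> T 0 || T 2 && T 3, T 4 -> T 5 || T 2 && T 3,
      T 2 -> [|| T 0 && T 1, T 1 && T 3 | T 3 && T 4],
      T 3 -> [|| T 1 && T 2, T 2 && T 4 | T 4 && T 5] &
      forall i, i < 3 -> T i -> T i.+1 -> T i.+2 -> ~~ T i.+3].
Proof.
move=> /(window_trace v) /=; rewrite -/(T 0) -/(T 1) -/(T 2) -/(T 3).
rewrite -/(T 4) -/(T 5) => tr.
split; last first.
  case=> [|[|[|//]]] _; move: tr;
    by case: (T 0); case: (T 1); case: (T 2); case: (T 3); case: (T 4);
       case: (T 5).
all: by move: tr; case: (T 0); case: (T 1); case: (T 2); case: (T 3);
       case: (T 4); case: (T 5).
Qed.

(** If [v] meets three consecutive vertices, the middle one is the centre of its trace. Otherwise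
    [v] meets at most the two outermost vertices on either side. *)
Lemma path_trace (k : nat) (p : nat -> G) (v : G)
    (T := fun n => cadj v (p n)) :
  5 < k -> induced_path k p ->
  ~ (T 0 /\ forall n, 0 < n < k -> ~~ T n) ->
  ~ (T k.-1 /\ forall n, n < k.-1 -> ~~ T n) ->
  ~ ([/\ T 0, T k.-1 & forall n, 0 < n < k.-1 -> ~~ T n]) ->
  (forall n, n < k -> ~~ T n) \/
  exists2 i, i < k & forall n, n < k -> T n = (i <= n.+1) && (n <= i.+1).
Proof.
move=> k6 pP noL noR noLR.
have W a : a + 6 <= k -> induced_path 6 (fun n => p (a + n)).
  by move=> ak i j Hi Hj; rewrite pP; lia.
have C x y z : x.+1 < y -> y.+1 < z -> z < k -> T x -> T y -> T z -> False.
  move=> xy yz zk Tx Ty Tz; have := no_claw v (p x) (p y) (p z).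
  by rewrite -/(T x) -/(T y) -/(T z) Tx Ty Tz !pP; lia.
case: (boolP [exists i : 'I_k, [&& 0 < i, i.+1 < k, T i.-1, T i & T i.+1]]).
  case/existsP=> -[i ik] /= /and5P[i0 i1k Ta Tb Tc].
  have no4 m : m.+3 < k -> T m -> T m.+1 -> T m.+2 -> ~~ T m.+3.
    (* The window starts at [m], or at [k - 6] if it would overrun the path; in both cases the
       offset [m - a] is at most 2. *)
    move=> mk; pose a := minn m (k - 6).
    have [_ _ _ _ /(_ (m - a))] := windowP v (W a ltac:(lia)).
    rewrite /= !addnS.
    have -> : a + (m - a) = m by lia.
    by apply; lia.
  right; exists i => // n nk.
  have [n1|n1] := boolP ((i <= n.+1) && (n <= i.+1)).
    have [->|[->|->]] // : n = i.-1 \/ n = i \/ n = i.+1 by lia.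
  apply/negbTE/negP => Tn.
  have [e|[e|[e|e]]] : n = i.+2 \/ n.+2 = i \/ i.+2 < n \/ n.+2 < i by lia.
  - have := no4 i.-1; rewrite prednK // -e; move=> /(_ nk Ta Tb Tc).
    by rewrite Tn.
  - have := no4 n; rewrite e; move=> /(_ i1k Tn).
    have -> : n.+1 = i.-1 by lia.
    by rewrite Ta Tb Tc => /(_ erefl erefl).
  - by apply: (C i.-1 i.+1 n) => //; lia.
  - by apply: (C n i.-1 i.+1) => //; lia.
move=> /existsPn no3.
have {}no3 i : 0 < i -> i.+1 < k -> T i.-1 -> T i -> T i.+1 -> False.
  move=> i0 ik Ta Tb Tc; have := no3 (Ordinal (ltnW ik)).
  by rewrite /= i0 ik Ta Tb Tc.
(* Every alternative of [windowP] at position 2 or 3 would complete three consecutive hits. Position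
   3 serves [j = k - 3], where a window starting at [j - 2] overruns the path. *)
have mid j : 1 < j -> j.+2 < k -> ~~ T j.
  move=> j1 jk; apply/negP => Tj.
  have [j3|j3] := ltnP j.+3 k.
    have [_ _ + _ _] := windowP v (W (j - 2) ltac:(lia)).
    rewrite -!/(T _).
    have [-> -> -> -> ->] : [/\ j - 2 + 0 = j.-2, j - 2 + 1 = j.-1,
      j - 2 + 2 = j, j - 2 + 3 = j.+1 & j - 2 + 4 = j.+2] by split; lia.
    move=> /(_ Tj) /or3P[]/andP[Ta Tb].
    + by apply: (no3 j.-1); rewrite ?prednK //; lia.
    + by apply: (no3 j) => //; lia.
    + by apply: (no3 j.+1) => //; lia.
  have [_ _ _ + _] := windowP v (W (j - 3) ltac:(lia)).
  rewrite -!/(T _).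
  have [-> -> -> -> ->] : [/\ j - 3 + 1 = j.-2, j - 3 + 2 = j.-1,
    j - 3 + 3 = j, j - 3 + 4 = j.+1 & j - 3 + 5 = j.+2] by split; lia.
  move=> /(_ Tj) /or3P[]/andP[Ta Tb].
  + by apply: (no3 j.-1); rewrite ?prednK //; lia.
  + by apply: (no3 j) => //; lia.
  + by apply: (no3 j.+1) => //; lia.
have T10 : T 1 -> T 0.
  have [+ _ _ _ _] := windowP v (W 0 ltac:(lia)).
  rewrite -!/(T _) !add0n => H /H /orP[//|/andP[T2 _]].
  by have := mid 2 isT ltac:(lia); rewrite T2.
have T1n : T k.-2 -> T k.-1.
  have [_ + _ _ _] := windowP v (W (k - 6) ltac:(lia)).
  rewrite -!/(T _).
  have [-> -> ->] : [/\ k - 6 + 4 = k.-2, k - 6 + 5 = k.-1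
    & k - 6 + 3 = k - 3] by split; lia.
  move=> H /H /orP[//|/andP[_ T2]].
  by have := mid (k - 3) ltac:(lia) ltac:(lia); rewrite T2.
have splitT n : n < k -> T n -> [\/ n = 0, n = 1, n = k.-2 | n = k.-1].
  move=> nk Tn.
  have [|n1] := leqP n 1; first by case: n Tn nk => [|[|//]] _ _ _;
    [constructor 1|constructor 2].
  have [nk2|nk2] := ltnP n.+2 k; first by have := mid n n1 nk2; rewrite Tn.
  have [->|->] : n = k.-2 \/ n = k.-1 by lia.
    by constructor 3.
  by constructor 4.
(* The triangle [v], [p 1], [p 0] with [p k.-1] pendant at [v] and the path [p 1], [p 2], [p 3] is a
   B_{1,2}; [BR] is the mirror image. *)
have BL : T 0 -> T 1 -> T k.-1 -> False.
  move=> T0 T1 Tk; have := no_B12 v (p 1) (p 0) (p k.-1) (p 2) (p 3).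
  have [/negbTE m2 /negbTE m3] := (mid 2 isT ltac:(lia), mid 3 isT ltac:(lia)).
  rewrite -!/(T _) T0 T1 Tk m2 m3.
  rewrite !pP; lia.
have BR : T 0 -> T k.-2 -> T k.-1 -> False.
  move=> T0 T1 Tk.
  have := no_B12 v (p k.-2) (p k.-1) (p 0) (p (k - 3)) (p (k - 4)).
  have /negbTE m3 := mid (k - 3) ltac:(lia) ltac:(lia).
  have /negbTE m4 := mid (k - 4) ltac:(lia) ltac:(lia).
  rewrite -!/(T _) T0 T1 Tk m3 m4.
  rewrite !pP; lia.
case T0: (T 0); case Tk: (T k.-1).
- case: noLR; split=> // n nk; apply/negP => Tn.
  have [||e|e|] := splitT n _ Tn; [lia|lia|subst n|subst n|lia].
    exact: BL.
  exact: BR.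
- have T2 : T k.-2 = false by apply/negP => /T1n; rewrite Tk.
  case T1: (T 1).
    right; exists 0; first lia.
    move=> n nk; have [n1|n1] := leqP n 1.
      by case: n n1 {nk} => [|[|]].
    apply/negP => Tn; case: (splitT n nk Tn) => e; subst n; move: Tn; [lia|lia| |].
      by rewrite T2.
    by rewrite Tk.
  case: noL; split=> // n nk; apply/negP => Tn.
  have [||||] := splitT n _ Tn; [lia|lia| | |] => e; move: Tn; rewrite e.
  + by rewrite T1.
  + by rewrite T2.
  + by rewrite Tk.
- have T1 : T 1 = false by apply/negP => /T10; rewrite T0.
  case T2: (T k.-2).
    right; exists k.-1; first lia.
    move=> n nk; have [n1|n1] := leqP k.-2 n.
      have [->|->] : n = k.-2 \/ n = k.-1 by lia.
        by rewrite T2; lia.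
      by rewrite Tk; lia.
    have -> : (k.-1 <= n.+1) = false by lia.
    apply/negP => Tn; case: (splitT n nk Tn) => e; move: Tn; [| |lia|lia].
      by rewrite e T0.
    by rewrite e T1.
  case: noR; split=> // n nk; apply/negP => Tn.
  have [||||] := splitT n _ Tn; [lia| | | |lia] => e; move: Tn; rewrite e.
  + by rewrite T0.
  + by rewrite T1.
  + by rewrite T2.
- left=> n nk; apply/negP => Tn.
  case: (splitT n nk Tn) => e; move: Tn; rewrite e.
  + by rewrite T0.
  + by move/T10; rewrite T0.
  + by move/T1n; rewrite Tk.
  + by rewrite Tk.
Qed.

End Windows.

(** * Blow-ups: nonempty cliques substituted for the vertices of a graph *)

Definition blowup (H G : sgraph) : Prop :=
  exists2 t : G -> H, cadj_embedding t & forall h, exists x, t x = h.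

Definition closed_trace (H G : sgraph) (f : H -> G) (v : G) : Prop :=
  exists i, forall h, cadj v (f h) = cadj i h.

Section Blowup.
Variables H G : sgraph.
Hypothesis twH : twin_free H.
Hypothesis no_isolated : forall i : H, exists2 j, j != i & cadj i j.
(** Excludes what two wrongly labelled vertices would produce: the closed neighbourhood of each
    label, toggled at the other label, is again a closed neighbourhood. *)
Hypothesis rigidH : forall i j i' j' : H,
  (forall h, cadj j' h = cadj j h (+) (h == i)) ->
  (forall h, cadj i' h = cadj i h (+) (h == j)) -> False.
Hypothesis connG : connected G.
Hypothesis traceG : forall f : H -> G, cadj_embedding f ->
  forall v h, cadj v (f h) -> closed_trace f v.

Lemma cadj_embedding_replace (f : H -> G) (x : G) (i : H) :
  cadj_embedding f -> (forall h, cadj x (f h) = cadj i h) ->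
  cadj_embedding (fun h => if h == i then x else f h).
Proof.
move=> fE xi h h'; case: eqP => [->|_]; case: eqP => [->|_] //.
- by rewrite !cadj_refl.
- by rewrite cadj_sym xi cadj_sym.
Qed.

Lemma blowup_of_closed_traces (f : H -> G) (h0 : H) :
  cadj_embedding f -> blowup H G.
Proof.
move=> fE.
have ftr x : closed_trace f x.
  (* Meeting the copy propagates along edges, hence from [f h0] to all of [G]. *)
  suff /existsP[h] : x \in [pred x | [exists h, cadj x (f h)]] by apply: traceG.
  rewrite -(closed_connect _ (connG (f h0) x)).
    by apply/existsP; exists h0; rewrite cadj_refl.
  apply: intro_closed; first exact/sym_connect_sym/adj_sym.
  move=> y z yz /existsP[h /(traceG fE) [i yi]].
  (* With [y] in place of [f i], the neighbour [z] of [y] meets the new copy; a vertex of its trace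
     other than [i] lies in the old copy too. *)
  have f'E := cadj_embedding_replace fE yi.
  have [|j zj] := traceG f'E (v := z) (h := i).
    by rewrite eqxx cadj_sym /cadj yz orbT.
  have [h' h'i h'j] : exists2 h', h' != i & cadj j h'.
    have [->|ji] := eqVneq j i; first exact: no_isolated.
    by exists j => //; apply: cadj_refl.
  by apply/existsP; exists h'; move: h'j; rewrite -zj (negbTE h'i).
pose lab x i := [forall h, cadj x (f h) == cadj i h].
have labP x i : reflect (forall h, cadj x (f h) = cadj i h) (lab x i).
  exact: 'forall_eqP.
(* The default [h0] is never taken, by [ftr]. *)
pose t x := odflt h0 [pick i | lab x i].
have tP x h : cadj x (f h) = cadj (t x) h.
  rewrite /t; case: pickP => [i /labP //|no].
  by have [i /labP] := ftr x; rewrite no.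
(* Substituting [x] for its label changes the trace of [y] exactly at [t x], and [traceG] makes the
   new trace closed once it is nonempty. *)
have flip x y : cadj x y = ~~ cadj (t x) (t y) ->
    exists j', forall h, cadj j' h = cadj (t y) h (+) (h == t x).
  move=> xy.
  have f'E := cadj_embedding_replace fE (tP x).
  have f'y h : cadj y (if h == t x then x else f h) =
      cadj (t y) h (+) (h == t x).
    case: eqP => [->|_]; first by rewrite cadj_sym xy addbT cadj_sym.
    by rewrite addbF tP.
  have [h yh] : exists h, cadj (t y) h (+) (h == t x).
    have [tyx|ntyx] := eqVneq (t y) (t x).
      have [h hx xh] := no_isolated (t x).
      by exists h; rewrite tyx xh (negbTE hx).
    by exists (t y); rewrite cadj_refl (negbTE ntyx).
  have [|j' j'P] := traceG f'E (v := y) (h := h); first by rewrite f'y.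
  by exists j' => h'; rewrite -j'P f'y.
exists t => [x y|h].
  apply/eqP/idPn => ne.
  have E : cadj x y = ~~ cadj (t x) (t y).
    by move: ne; case: (cadj x y); case: (cadj _ _).
  have [j' j'P] := flip x y E.
  have [|i' i'P] := flip y x; first by rewrite cadj_sym E cadj_sym.
  exact: (rigidH j'P i'P).
(* The label of [f h] has the closed neighbourhood of [h]. *)
exists (f h); apply: twH => h'.
by rewrite -tP fE.
Qed.

End Blowup.

(** * Fat graphs as blow-ups *)

Lemma cadj_graph_of (T : finType) (r : rel T) (x y : graph_of r) :
  cadj x y = [|| x == y, r x y | r y x].
Proof. by rewrite /cadj /= /sym_adj; case: eqP. Qed.

Section FatGraphs.
Variables (I : finType) (r : rel I).

(** [fat_path] and [fat_cycle] are, by conversion, the instances for the relations of [path_graph]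
    and [cycle_graph]. *)
Definition fat_graph (L : I -> finType) : sgraph :=
  graph_of (fun u v : {i : I & L i} =>
    (tag u == tag v) || r (tag u) (tag v)).

Lemma cadj_fat_graph (L : I -> finType) (u v : fat_graph L) :
  cadj u v = cadj (tag u : graph_of r) (tag v).
Proof.
rewrite !cadj_graph_of eq_sym (eq_sym (tag v)).
have [->|_] := eqVneq u v; first by rewrite eqxx.
by case: (tag u == tag v).
Qed.

Lemma fat_graph_of_blowup (G : sgraph) : blowup (graph_of r) G ->
  exists L : I -> finType, (forall i, 0 < #|L i|) /\ isomorphic G (fat_graph L).
Proof.
move=> [t tE tS]; pose L i : finType := {x : G | t x == i}.
exists L; split=> [i|].
  have [x xi] := tS i; apply/card_gt0P.
  by exists (exist _ x (introT eqP xi)).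
pose F x : fat_graph L := Tagged L (exist _ x (eqxx (t x)) : L (t x)).
pose F' (u : fat_graph L) : G := val (tagged u).
have FK : cancel F F' by [].
exists F.
  exists F' => // -[i [x Hx]].
  have e : t x = i by apply/eqP.
  subst i; rewrite /F /F' /=.
  by congr existT; apply: val_inj.
move=> x y; rewrite !adjE (inj_eq (can_inj FK)).
by rewrite cadj_fat_graph /= -tE.
Qed.

(** One vertex chosen from each clique yields a copy of [graph_of r] in [G]. *)
Lemma embedding_of_fat_graph (H G : sgraph) (L : I -> finType)
    (f : H -> graph_of r) :
  (forall i, 0 < #|L i|) -> isomorphic G (fat_graph L) ->
  cadj_embedding f -> exists g : H -> G, cadj_embedding g.
Proof.
move=> L0 [F [F' F'K FK] FE] fE.
have pickL i : exists x : L i, true by have /card_gt0P[x _] := L0 i; exists x.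
pose rep i : L i := xchoose (pickL i).
exists (fun h => F' (Tagged L (rep (f h)))) => x y.
rewrite /cadj -FE !FK (can_eq FK) -/(cadj _ _).
by rewrite cadj_fat_graph /= fE.
Qed.

End FatGraphs.

(** * Twins and near twins in paths and cycles *)

Lemma cadj_path (k : nat) (i j : path_graph k) :
  cadj i j = (i <= j.+1) && (j <= i.+1).
Proof. by rewrite cadj_graph_of -val_eqE /=; lia. Qed.

(** It has [l.+1] vertices, so [cycle_graph k] is a path of order [k] closed by one more vertex. *)
Definition cycle_graph (l : nat) : sgraph :=
  graph_of (fun i j : 'I_l.+1 => ordS i == j).

Lemma cadj_cycle (l : nat) (i j : cycle_graph l) : 1 < l ->
  cadj i j = [|| (i <= j.+1) && (j <= i.+1), (i == 0 :> nat) && (j == l :> nat)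
               | (j == 0 :> nat) && (i == l :> nat)].
Proof.
move=> l1; rewrite cadj_graph_of -!val_eqE /=.
have mE (n : 'I_l.+1) : n.+1 %% l.+1 = if n == l :> nat then 0 else n.+1.
  case: eqP => [->|/eqP nl]; first by rewrite modnn.
  by rewrite modn_small //; have := ltn_ord n; lia.
rewrite !mE; have := ltn_ord i; have := ltn_ord j.
by case: (eqVneq (i : nat) l); case: (eqVneq (j : nat) l); lia.
Qed.

(** The two closed neighbourhoods differ at [j.-1] and [j'.+1] when these exist, and at [j] and [j']
    unless [j' = j.+1]. Only one difference is allowed, so the pair is consecutive and at an end of
    the path. *)
Lemma path_near_twins_lt (k i j j' : nat) : 5 < k -> j < j' -> j' < k ->
  (forall n, n < k -> (j' <= n.+1) && (n <= j'.+1) !=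
                      (j <= n.+1) && (n <= j.+1) -> n = i) ->
  (i = 2 /\ j' = 1) \/ (i.+3 = k /\ j.+2 = k).
Proof.
move=> k6 jj' j'k D.
have Dl : 0 < j -> j.-1 = i by move=> j0; apply: D; lia.
have Dr : j'.+1 < k -> j'.+1 = i by move=> kj; apply: D; lia.
have j'E : j' = j.+1.
  have [j'j|] := ltnP j.+1 j'; last lia.
  have : j = i by apply: D; lia.
  have : j' = i by apply: D; lia.
  lia.
lia.
Qed.

(** The positions allowed for [i] and for [j] are disjoint, so the roles cannot be swapped; this
    gives rigidity. *)
Lemma path_near_twins (k : nat) (i j j' : path_graph k) : 5 < k ->
  (forall h, cadj j' h = cadj j h (+) (h == i)) ->
  ((i == 2 :> nat) || (i.+3 == k)) && ((j <= 1) || (k <= j.+2)).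
Proof.
move=> k6 E.
have D n : n < k -> (j' <= n.+1) && (n <= j'.+1) !=
                    (j <= n.+1) && (n <= j.+1) -> n = i.
  move=> nk; have := E (Ordinal nk); rewrite !cadj_path /= => ->.
  by rewrite -val_eqE /=; case: (n =P i) => //; rewrite addbF eqxx.
have := ltn_ord j; have := ltn_ord j'.
have [jj'|jj'|/val_inj jj'] := ltngtP j j' => j'k jk.
- have := path_near_twins_lt k6 jj' j'k D; lia.
- have := @path_near_twins_lt k i j' j k6 jj' jk.
  by move=> /(_ (fun n nk ne => D n nk ltac:(rewrite eq_sym; exact: ne))); lia.
- by have := E i; rewrite jj' eqxx addbT; case: (cadj _ _).
Qed.

Lemma twin_free_path (k : nat) : 2 < k -> twin_free (path_graph k).
Proof.
move=> k2 i j E; apply/val_inj => /=.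
have {}E n : n < k -> (i <= n.+1) && (n <= i.+1) = (j <= n.+1) && (n <= j.+1).
  by move=> nk; have := E (Ordinal nk); rewrite !cadj_path.
have := ltn_ord i; have := ltn_ord j.
have := E i.-1; have := E i.+1; have := E j.-1; have := E j.+1; lia.
Qed.

(** Brings any vertex to an index away from the wrap-around, where adjacency is plain arithmetic. *)
Lemma cycle_rotation (l : nat) (i j : cycle_graph l) :
  exists2 s : cycle_graph l -> cycle_graph l,
    [/\ cadj_embedding s, bijective s & forall x, s (ordS x) = ordS (s x)]
    & s i = j.
Proof.
have ordS_emb : cadj_embedding (@ordS l.+1 : cycle_graph l -> cycle_graph l).
  by move=> x y; rewrite !cadj_graph_of !(inj_eq (can_inj (@ordSK l.+1))).
pose rot n : cycle_graph l -> cycle_graph l := iter n (@ordS l.+1).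
have rotP n : [/\ cadj_embedding (rot n), bijective (rot n) &
    forall x, rot n (ordS x) = ordS (rot n x)].
  elim: n => [|n [IHe IHb IHS]]; first by split=> //; exists id.
  split=> [x y||x]; first by rewrite /rot /= ordS_emb IHe.
    exact: bij_comp (ordS_bij l.+1) IHb.
  by rewrite /= IHS.
have rotE n x : rot n x = (x + n) %% l.+1 :> nat.
  elim: n => [|n IHn] /=; first by rewrite addn0 modn_small.
  by rewrite IHn -addn1 modnDml addn1 addnS.
(* [l.+1 - i] stands for -i modulo [l.+1]. *)
exists (rot (j + (l.+1 - i))); first exact: rotP.
apply/val_inj; rewrite /= rotE addnCA subnKC 1?ltnW //.
by rewrite modnDr modn_small.
Qed.

(* At [b = false] this says that cycles have no twins. *)
Lemma cycle_near_twins (l : nat) (i j j' : cycle_graph l) (b : bool) :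
  5 < l -> (forall h, cadj j' h = cadj j h (+) (b && (h == i))) ->
  j = j' /\ ~~ b.
Proof.
move=> l6.
(* With [j] moved to 3, its closed neighbourhood is {2, 3, 4}, and the indices 0 to 6 all exist. *)
have [s [sE [s' sK s'K] _] <-] := cycle_rotation (inord 3) j.
rewrite -{1 2}[j']s'K -[i]s'K; move: (s' i) (s' j') => {}i {}j' E.
have En n : n < 7 -> cadj j' (inord n) =
    cadj (inord 3 : cycle_graph l) (inord n) (+) (b && (n == i)).
  move=> n7; have := E (s (inord n)); rewrite !sE (can_eq sK) => ->.
  by rewrite -val_eqE /= inordK //; lia.
suff [e nb] : j' = 3 :> nat /\ ~~ b.
  by split=> //; congr s; apply: val_inj; rewrite /= inordK //; lia.
have D n : n < 7 ->
    cadj j' (inord n) != cadj (inord 3 : cycle_graph l) (inord n) ->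
    b /\ n = i.
  by move=> n7; rewrite En //; case: b {E En}; case: (n =P i) => //;
    rewrite addbF eqxx.
have l1 : 1 < l by lia.
have {}D n : n < 7 -> [|| (j' <= n.+1) && (n <= j'.+1),
    (j' == 0 :> nat) && (n == l) | (n == 0) && (j' == l :> nat)] !=
    (1 < n < 5) -> b /\ n = i.
  move=> n7 neq; apply: D => //; rewrite !cadj_cycle // !inordK; lia.
(* Every [j'] other than 3 disagrees with 3 at two indices below 7, while disagreement is possible
   only at [i]. *)
have two (m n : nat) : m != n -> b /\ m = i -> b /\ n = i -> False.
  by move=> mn [_ mi] [_ ni]; rewrite mi ni eqxx in mn.
have [j1|[j2|[j3|[j4|j5]]]] :
    (j' <= 1) \/ j' = 2 :> nat \/ j' = 3 :> nat \/ j' = 4 :> nat \/ (4 < j').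
  by lia.
- by case: (two 3 4) => //; apply: D; lia.
- by case: (two 1 4) => //; apply: D; lia.
- split=> //; have e : inord 3 = j' by apply: val_inj; rewrite /= inordK; lia.
  by have := E (s i); rewrite e eqxx andbT;
    case: b {E En D two}; case: (cadj _ _).
- by case: (two 2 5) => //; apply: D; lia.
- by case: (two 2 3) => //; apply: D; lia.
Qed.

Lemma twin_free_cycle (l : nat) : 5 < l -> twin_free (cycle_graph l).
Proof.
move=> l6 i j E.
by have [] := @cycle_near_twins l i i j false l6 => // h; rewrite E addbF.
Qed.

Lemma ordS_inord (l n : nat) : n < l -> ordS (inord n : 'I_l.+1) = inord n.+1.
Proof.
move=> nl; apply: val_inj; rewrite /= !inordK ?modn_small //; lia.
Qed.

Lemma closed_trace_comp (H G : sgraph) (f : H -> G) (s : H -> H) (v : G) :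
  cadj_embedding s -> bijective s -> closed_trace (f \o s) v ->
  closed_trace f v.
Proof.
move=> sE [s' sK s'K] [i iP]; exists (s i) => h.
by rewrite -[h]s'K sE -iP.
Qed.

(** * Traces on longest paths and on cycles *)

Section Traces.
Variable G : sgraph.
Hypothesis Gfree : free (family2 claw B12) G.

Lemma induced_path_cycle (l : nat) (f : cycle_graph l -> G) :
  5 < l -> cadj_embedding f -> induced_path 6 (fun n => f (inord n)).
Proof.
by move=> l6 fE i j i6 j6; rewrite fE cadj_cycle ?inordK; lia.
Qed.

Lemma cycle_trace (l : nat) (f : cycle_graph l -> G) (v : G)
    (h : cycle_graph l) :
  5 < l -> cadj_embedding f -> cadj v (f h) -> closed_trace f v.
Proof.
move=> l6.
pose T (g : cycle_graph l -> G) n := cadj v (g (inord n)).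
(* A further hit at 1 or 5 makes four consecutive ones; anywhere else it forms a claw at [v] with 2
   and 4. *)
have centered g : cadj_embedding g -> T g 2 -> T g 3 -> T g 4 ->
    closed_trace g v.
  move=> gE T2 T3 T4; exists (inord 3) => x; rewrite -[x]inord_val.
  have xl := ltn_ord x; rewrite -/(T g x).
  rewrite cadj_cycle ?inordK //; try lia.
  have -> : [|| (3 <= x.+1) && (x <= 4), (3 == 0) && (x == l :> nat) |
                (x == 0 :> nat) && (3 == l)] = (1 < x < 5) by lia.
  have [x1|x1] := boolP (1 < x < 5).
    by have [->|[->|->]] : x = 2 :> nat \/ x = 3 :> nat \/ x = 4 :> nat by lia.
  apply/negbTE/negP => Tx.
  have [_ _ _ _ W] := windowP Gfree v (induced_path_cycle l6 gE).
  have [x1'|[x5|xfar]] :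
    x = 1 :> nat \/ x = 5 :> nat \/ (x == 0 :> nat) || (5 < x) by lia.
  - by have := W 1 isT; rewrite -!/(T g _) -{1}x1' Tx T2 T3 T4 => /(_ isT isT isT).
  - by have := W 2 isT; rewrite -!/(T g _) T2 T3 T4 -x5 Tx => /(_ isT isT isT).
  - have := no_claw Gfree v (g (inord 2)) (g (inord 4)) (g (inord x)).
    by rewrite -!/(T g _) T2 T4 Tx !gE !cadj_cycle ?inordK; lia.
have triple g a : cadj_embedding g -> a.+2 <= l ->
    T g a -> T g a.+1 -> T g a.+2 -> closed_trace g v.
  move=> gE al Ta Tb Tc.
  have [s [sE sB sS] s2] := cycle_rotation (inord 2) (inord a : cycle_graph l).
  have s3 : s (inord 3) = inord a.+1.
    by rewrite -ordS_inord ?sS ?s2 ?ordS_inord //; lia.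
  have s4 : s (inord 4) = inord a.+2.
    by rewrite -ordS_inord ?sS ?s3 ?ordS_inord //; lia.
  apply: (closed_trace_comp sE sB); apply: centered.
  - by move=> x y; rewrite /= gE sE.
  - by rewrite /T /= s2.
  - by rewrite /T /= s3.
  - by rewrite /T /= s4.
move=> fE vh.
(* At position 3, [windowP] completes the hit [h] to three consecutive ones. *)
have [s [sE sB _] s3] := cycle_rotation (inord 3) h.
have gE : cadj_embedding (f \o s) by move=> x y; rewrite /= fE sE.
apply: (closed_trace_comp sE sB).
have [_ _ _ + _] := windowP Gfree v (induced_path_cycle l6 gE).
rewrite -!/(T _ _); have -> : T (f \o s) 3 by rewrite /T /= s3.
move=> /(_ isT) /or3P[]/andP[Ta Tb].
- by apply: (triple _ 1) => //; [lia|rewrite /T /= s3].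
- by apply: (triple _ 2) => //; [lia|rewrite /T /= s3].
- by apply: (triple _ 3) => //; [lia|rewrite /T /= s3].
Qed.

(** The exceptional traces of [path_trace] prepend [v] to the path, append it, or close the path to
    a cycle; all three are excluded. *)
Lemma maximal_path_trace (k : nat) (f : path_graph k -> G) (v : G)
    (h : path_graph k) :
  5 < k -> ~~ cadj_embeddable (path_graph k.+1) G ->
  ~~ cadj_embeddable (cycle_graph k) G ->
  cadj_embedding f -> cadj v (f h) -> closed_trace f v.
Proof.
(* The order is now [k.+1], as [inord] requires. *)
case: k f h => // k f h k6 noP noC fE vh.
pose p n := f (inord n).
have pP : induced_path k.+1 p.
  by move=> i j ik jk; rewrite /p fE cadj_path !inordK.
have fp x : f x = p x by rewrite /p inord_val.
have [|||noT|[i ik iP]] := @path_trace _ Gfree k.+1 p v k6 pP.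
- case=> T0 Tn; case/cadj_embeddableP: noP.
  exists (fun i : 'I_k.+2 => if i == 0 :> nat then v else p i.-1) => x y.
  have := ltn_ord x; have := ltn_ord y; rewrite cadj_path => yk xk.
  have Tv z : 0 < z < k.+2 -> cadj v (p z.-1) = (z <= 1).
    by case: z => [|[|z]] // zk; apply/negbTE/Tn; lia.
  case: eqP => [->|x0]; case: eqP => [->|y0].
  + by rewrite cadj_refl.
  + by rewrite Tv; lia.
  + by rewrite cadj_sym Tv; lia.
  + by rewrite pP; lia.
- case=> /= Tk Tn; case/cadj_embeddableP: noP.
  exists (fun i : 'I_k.+2 => if i == k.+1 :> nat then v else p i) => x y.
  have := ltn_ord x; have := ltn_ord y; rewrite cadj_path => yk xk.
  have Tv z : z < k.+1 -> cadj v (p z) = (k <= z).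
    move=> zk; have [kz|kz] := leqP k z; last by apply/negbTE/Tn.
    by have -> : z = k by lia.
  case: eqP => [->|x0]; case: eqP => [->|y0].
  + by rewrite cadj_refl; lia.
  + by rewrite Tv; lia.
  + by rewrite cadj_sym Tv; lia.
  + by rewrite pP; lia.
- case=> /= T0 Tk Tn; case/cadj_embeddableP: noC.
  exists (fun i : 'I_k.+2 => if i == k.+1 :> nat then v else p i) => x y.
  have := ltn_ord x; have := ltn_ord y; rewrite cadj_cycle => [yk xk|]; last lia.
  have Tv z : z < k.+1 -> cadj v (p z) = (z == 0) || (z == k).
    case: z => [|z] zk /=; first exact: T0.
    by case: eqP => [->|zk']; [exact: Tk|apply/negbTE/Tn; lia].
  case: eqP => [->|x0]; case: eqP => [->|y0].
  + by rewrite cadj_refl; lia.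
  + by rewrite Tv; lia.
  + by rewrite cadj_sym Tv; lia.
  + by rewrite pP; lia.
- by have := noT h (ltn_ord h); rewrite -fp vh.
- exists (Ordinal ik) => x; rewrite fp iP ?cadj_path //.
Qed.

End Traces.

(** * Blow-up structure of the graph and the equivalence *)

Lemma blowup_path (G : sgraph) (k : nat) : connected G ->
  free (family2 claw B12) G -> 5 < k -> cadj_embeddable (path_graph k) G ->
  ~~ cadj_embeddable (path_graph k.+1) G ->
  ~~ cadj_embeddable (cycle_graph k) G -> blowup (path_graph k) G.
Proof.
move=> Gconn Gfree k6 /cadj_embeddableP[f fE] noP noC.
have k0 : 0 < k by lia.
apply: (@blowup_of_closed_traces (path_graph k) G _ _ _ Gconn _ f
         (Ordinal k0) fE).
- by apply: twin_free_path; lia.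
- move=> i; have := ltn_ord i => ik.
  have nk : (if i == 0 :> nat then 1 else i.-1) < k by case: eqP; lia.
  exists (Ordinal nk); first by rewrite -val_eqE /=; case: ifP; lia.
  by rewrite cadj_path /=; case: ifP; lia.
- move=> i j i' j' /(path_near_twins k6) Eij /(path_near_twins k6) Eji.
  by move: Eij Eji; lia.
- by move=> g gE v h; apply: maximal_path_trace.
Qed.

Lemma blowup_cycle (G : sgraph) (l : nat) : connected G ->
  free (family2 claw B12) G -> 5 < l -> cadj_embeddable (cycle_graph l) G ->
  blowup (cycle_graph l) G.
Proof.
move=> Gconn Gfree l6 /cadj_embeddableP[f fE].
apply: (@blowup_of_closed_traces (cycle_graph l) G _ _ _ Gconn _ f ord0 fE).
- exact: twin_free_cycle.
- move=> i; exists (ordS i); last by rewrite cadj_graph_of eqxx orbT.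
  rewrite -val_eqE /=; have [il|il] := eqVneq (i : nat) l.
    by rewrite il modnn; lia.
  by rewrite modn_small; have := ltn_ord i; lia.
- move=> i j i' j' E _.
  by have [] := @cycle_near_twins l i j j' true l6.
- by move=> g gE v h; apply: cycle_trace.
Qed.

Theorem theorem1p3 (G : sgraph) :
  connected G -> free (family2 claw B12) G ->
  (~ free (family1 (path_graph 6)) G <-> fat_family 6 G).
Proof.
move=> Gconn Gfree; have tw6 := @twin_free_path 6 isT.
split=> [notfree | [l l6 fat] Pfree].
  (* The first conjunct carries [5 < k] over to the maximal [k]. *)
  have P6 : (5 < 6) && cadj_embeddable (path_graph 6) G.
    rewrite /=; have [//|/cadj_embeddableP noP] := boolP (cadj_embeddable _ G).
    by case: notfree => _ -> /(induced_subgraphP G tw6).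
  have bound k : (5 < k) && cadj_embeddable (path_graph k) G -> k <= #|G|.
    case/andP=> k6 /cadj_embeddableP[f fE].
    have twk : twin_free (path_graph k) by apply: twin_free_path; lia.
    by rewrite -[k in k <= _]card_ord (leq_card f (cadj_embedding_inj twk fE)).
  case: (ex_maxnP (ex_intro _ 6 P6) bound) => k /andP[k6 Pk] kmax.
  exists k => //.
  have [Ck|noC] := boolP (cadj_embeddable (cycle_graph k) G).
    right; split; first exact: ltnW.
    have := blowup_cycle Gconn Gfree k6 Ck.
    exact: fat_graph_of_blowup.
  left; split; first exact: ltnW.
  have noP : ~~ cadj_embeddable (path_graph k.+1) G.
    by apply/negP => Pk1; have := kmax k.+1; rewrite Pk1 ltnn ltnW // => /(_ isT).
  have := blowup_path Gconn Gfree k6 Pk noP noC.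
  exact: fat_graph_of_blowup.
apply: (Pfree _ erefl); apply/(induced_subgraphP G tw6).
(* The cliques of index 0 to 5 provide the path; in a cycle, [l6] keeps those of index 0 and 5
   non-adjacent. *)
case: fat => -[_ [L [L0 iso]]].
  have le6 (i : path_graph 6) : i < l by apply: leq_trans l6.
  apply: (embedding_of_fat_graph L0 iso
           (f := fun i => Ordinal (le6 i) : path_graph l)).
  by move=> i j; rewrite !cadj_path.
have le6 (i : path_graph 6) : i < l.+1 by apply: leq_trans (ltnW _).
apply: (embedding_of_fat_graph L0 iso
         (f := fun i => Ordinal (le6 i) : cycle_graph l)).
move=> i j; rewrite cadj_cycle ?cadj_path /=; last lia.
by have := ltn_ord i; have := ltn_ord j; lia.
Qed.
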